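(* Let $B$ be an algebra and let $(J_i)_{i\in I}$ be a covering of $B$ with index set $I=\{1,2,\ldots,n\}$. Assume that $$\bigcap_{i=1,\ldots,k-1}(J_i+J_k)=\Bigl(\bigcap_{i=1,\ldots,k-1}J_i\Bigr)+J_k\qquad\text{for all } k\in I.$$ Then the covering $(J_i)_{i\in I}$ is complete.
   Context: Algebras are associative unital algebras over $\mathbb{C}$; ideals are two-sided. The empty intersection of ideals of $B$ (occurring for $k=1$) is understood as $B$, so the condition for $k=1$ is vacuous. A finite family $(J_i)_{i\in I}$ of ideals of $B$ is a covering of $B$ if $\bigcap_{i\in I} J_i=\{0\}$. Put $B_i=B/J_i$, $B_{ij}=B/(J_i+J_j)$, let $\pi_i:B\to B_i$ be the quotient maps and $\pi^i_j:B_i\to B_{ij}$, $b+J_i\mapsto b+J_i+J_j$. The covering completion of $B$ is $B_c=\{(a_i)_{i\in I}\in\bigoplus_{i\in I}B_i \mid \pi^i_j(a_i)=\pi^j_i(a_j)\ \forall i,j\in I\}$. The covering is called complete if the (injective) homomorphism $K:B\to B_c$, $K(a)=(\pi_i(a))_{i\in I}$, is surjective. *)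

(* Defs.v *)
From HB Require Import structures.
From mathcomp Require Import all_boot all_order all_algebra.
From mathcomp Require Import generic_quotient ring_quotient.
From mathcomp Require Import boolp classical_sets functions reals.
From mathcomp Require Import complex.

Set Implicit Arguments.
Unset Strict Implicit.
Unset Printing Implicit Defensive.

Import GRing.Theory.
Local Open Scope ring_scope.
Local Open Scope quotient_scope.
Local Open Scope classical_set_scope.

(* Associative unital algebras, possibly zero. The library's algType excludes
   the zero algebra, which is allowed here both as B itself and as a quotient
   B/J with J = B. A structure joining pzRingType and lmodType cannot be
   declared on top of the library's hierarchy, so the multiplication is part of
   the mixin and the pzRingType structure is derived from it below. *)
HB.mixin Record Lmodule_isPzAlgebra (R : pzRingType) A
    of GRing.Lmodule R A := {
  pzalg_one : A;
  pzalg_mul : A -> A -> A;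
  pzalg_mulA : associative pzalg_mul;
  pzalg_mul1l : left_id pzalg_one pzalg_mul;
  pzalg_mul1r : right_id pzalg_one pzalg_mul;
  pzalg_mulDl : left_distributive pzalg_mul +%R;
  pzalg_mulDr : right_distributive pzalg_mul +%R;
  pzalg_scaleAl : forall (a : R) (u v : A),
    a *: pzalg_mul u v = pzalg_mul (a *: u) v;
  pzalg_scaleAr : forall (a : R) (u v : A),
    a *: pzalg_mul u v = pzalg_mul u (a *: v)
}.

#[short(type="pzAlgType")]
HB.structure Definition PzAlgebra (R : pzRingType) :=
  {A of GRing.Lmodule R A & Lmodule_isPzAlgebra R A}.

HB.instance Definition _ (R : pzRingType) (A : pzAlgType R) :=
  GRing.Zmodule_isPzRing.Build (PzAlgebra.sort A) (@pzalg_mulA R A)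
    (@pzalg_mul1l R A) (@pzalg_mul1r R A) (@pzalg_mulDl R A) (@pzalg_mulDr R A).

Lemma pzscalerAl (R : pzRingType) (A : pzAlgType R) (a : R) (u v : A) :
  a *: (u * v) = (a *: u) * v.
Proof. exact: pzalg_scaleAl. Qed.

Lemma pzscalerAr (R : pzRingType) (A : pzAlgType R) (a : R) (u v : A) :
  a *: (u * v) = u * (a *: v).
Proof. exact: pzalg_scaleAr. Qed.

Definition pzAlg_of_alg (R : pzRingType) (A : algType R) : pzAlgType R :=
  HB.pack (GRing.Algebra.sort A)
    (Lmodule_isPzAlgebra.Build R (GRing.Algebra.sort A) (@mulrA A) (@mul1r A)
      (@mulr1 A) (@mulrDl A) (@mulrDr A) (@scalerAl R A) (@scalerAr R A)).

(* Closure under scalars follows from the unit of the algebra, see idealZ. *)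
Record ideal (R : pzRingType) (B : pzAlgType R) := Ideal {
  ideal_set :> set B;
  ideal0 : ideal_set 0;
  idealB : forall x y, ideal_set x -> ideal_set y -> ideal_set (x - y);
  idealMl : forall b x, ideal_set x -> ideal_set (b * x);
  idealMr : forall b x, ideal_set x -> ideal_set (x * b)
}.

Lemma idealZ (R : pzRingType) (B : pzAlgType R) (J : ideal B) (a : R) x :
  ideal_set J x -> ideal_set J (a *: x).
Proof. by move=> Jx; rewrite -[x]mul1r pzscalerAl; apply: idealMl. Qed.

Definition sumset (V : zmodType) (X Y : set V) : set V :=
  [set x + y | x in X & y in Y].

Section IdealSum.
Variables (R : pzRingType) (B : pzAlgType R) (J1 J2 : ideal B).

Lemma ideal_add0 : sumset J1 J2 0.
Proof. by exists 0; [exact: ideal0 | exists 0; [exact: ideal0 | rewrite addr0]]. Qed.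

Lemma ideal_addB x y :
  sumset J1 J2 x -> sumset J1 J2 y -> sumset J1 J2 (x - y).
Proof.
move=> [a Ja [b Jb <-]] [c Jc [d Jd <-]].
exists (a - c); first exact: idealB.
by exists (b - d); [exact: idealB | rewrite opprD addrACA].
Qed.

Lemma ideal_addMl b x : sumset J1 J2 x -> sumset J1 J2 (b * x).
Proof.
move=> [c Jc [d Jd <-]]; exists (b * c); first exact: idealMl.
by exists (b * d); [exact: idealMl | rewrite mulrDr].
Qed.

Lemma ideal_addMr b x : sumset J1 J2 x -> sumset J1 J2 (x * b).
Proof.
move=> [c Jc [d Jd <-]]; exists (c * b); first exact: idealMr.
by exists (d * b); [exact: idealMr | rewrite mulrDl].
Qed.

Definition ideal_add : ideal B :=
  Ideal ideal_add0 ideal_addB ideal_addMl ideal_addMr.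

Lemma ideal_addl : J1 `<=` ideal_add.
Proof. by move=> x Jx; exists x => //; exists 0; [exact: ideal0|rewrite addr0]. Qed.

Lemma ideal_addr : J2 `<=` ideal_add.
Proof. by move=> x Jx; exists 0; [exact: ideal0|exists x; rewrite ?add0r]. Qed.

End IdealSum.

Section Quotient.
Variables (R : pzRingType) (B : pzAlgType R) (J : ideal B).

Definition ideal_pred : {pred B} := fun x => `[< ideal_set J x >].

Lemma ideal_predP x : reflect (ideal_set J x) (x \in ideal_pred).
Proof. exact: asboolP. Qed.

Lemma ideal_pred_zmod : zmod_closed ideal_pred.
Proof.
split=> [|x y /ideal_predP Jx /ideal_predP Jy]; apply/ideal_predP.
  exact: ideal0.
exact: idealB.
Qed.

HB.instance Definition _ := GRing.isZmodClosed.Build B ideal_pred ideal_pred_zmod.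

(* The library makes the quotient an additive group; its ring structure there
   is restricted to proper ideals of commutative rings. *)
Definition quotient : Type := Quotient.quot ideal_pred.

HB.instance Definition _ := EqQuotient.on quotient.
HB.instance Definition _ := GRing.Zmodule.on quotient.
HB.instance Definition _ := ZmodQuotient.on quotient.

Definition proj (b : B) : quotient := \pi_quotient b.

Lemma projP x y : proj x = proj y <-> ideal_set J (x - y).
Proof.
split=> [/eqP|Jxy].
  by rewrite -Quotient.idealrBE => /ideal_predP.
by apply/eqP; rewrite -Quotient.idealrBE; apply/ideal_predP.
Qed.

Lemma projK (x : quotient) : proj (repr x) = x.
Proof. exact: reprK. Qed.

Lemma proj_zmod : zmod_morphism proj.
Proof. by move=> x y; rewrite /proj raddfB. Qed.

HB.instance Definition _ := GRing.isZmodMorphism.Build B quotient proj proj_zmod.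

Lemma quot_reprP b : ideal_set J (repr (proj b) - b).
Proof. by apply/projP; rewrite projK. Qed.

Definition quot_one : quotient := proj 1.
Definition quot_mul (x y : quotient) : quotient := proj (repr x * repr y).
Definition quot_scale (a : R) (x : quotient) : quotient := proj (a *: repr x).

Lemma quot_mulE x y : quot_mul (proj x) (proj y) = proj (x * y).
Proof.
apply/projP; set x' := repr _; set y' := repr _.
have -> : x' * y' - x * y = (x' - x) * y' - x * (y - y').
  by rewrite mulrBl mulrBr opprB addrA subrK.
by apply: idealB; [apply/idealMr/quot_reprP|apply/idealMl/projP; rewrite projK].
Qed.

Lemma quot_scaleE a x : quot_scale a (proj x) = proj (a *: x).
Proof. by apply/projP; rewrite -scalerBr; apply/idealZ/quot_reprP. Qed.

Fact quot_mulA : associative quot_mul.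
Proof.
by move=> x y z; rewrite -[x]projK -[y]projK -[z]projK !quot_mulE mulrA.
Qed.
Fact quot_mul1 : left_id quot_one quot_mul.
Proof. by move=> x; rewrite -[x]projK quot_mulE mul1r. Qed.
Fact quot_mulr1 : right_id quot_one quot_mul.
Proof. by move=> x; rewrite -[x]projK quot_mulE mulr1. Qed.
Fact quot_mulDl : left_distributive quot_mul +%R.
Proof.
move=> x y z; rewrite -[x]projK -[y]projK -[z]projK.
by rewrite -raddfD !quot_mulE mulrDl raddfD.
Qed.
Fact quot_mulDr : right_distributive quot_mul +%R.
Proof.
move=> x y z; rewrite -[x]projK -[y]projK -[z]projK.
by rewrite -raddfD !quot_mulE mulrDr raddfD.
Qed.

HB.instance Definition _ := GRing.Zmodule_isPzRing.Build quotient
  quot_mulA quot_mul1 quot_mulr1 quot_mulDl quot_mulDr.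

Fact quot_scaleA a b x : quot_scale a (quot_scale b x) = quot_scale (a * b) x.
Proof. by rewrite -[x]projK !quot_scaleE scalerA. Qed.
Fact quot_scale1 : left_id 1 quot_scale.
Proof. by move=> x; rewrite -[x]projK quot_scaleE scale1r. Qed.
Fact quot_scaleDr : right_distributive quot_scale +%R.
Proof.
move=> a x y; rewrite -[x]projK -[y]projK.
by rewrite -raddfD !quot_scaleE scalerDr raddfD.
Qed.
Fact quot_scaleDl x : {morph quot_scale^~ x : a b / a + b}.
Proof. by move=> a b; rewrite -[x]projK !quot_scaleE scalerDl raddfD. Qed.

HB.instance Definition _ := GRing.Zmodule_isLmodule.Build R quotient
  quot_scaleA quot_scale1 quot_scaleDr quot_scaleDl.

Fact quot_scaleAl (a : R) (x y : quotient) :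
  a *: quot_mul x y = quot_mul (a *: x) y.
Proof.
change (quot_scale a (quot_mul x y) = quot_mul (quot_scale a x) y).
by rewrite -[x]projK -[y]projK quot_mulE !quot_scaleE quot_mulE pzscalerAl.
Qed.
Fact quot_scaleAr (a : R) (x y : quotient) :
  a *: quot_mul x y = quot_mul x (a *: y).
Proof.
change (quot_scale a (quot_mul x y) = quot_mul x (quot_scale a y)).
by rewrite -[x]projK -[y]projK quot_mulE !quot_scaleE quot_mulE pzscalerAr.
Qed.

HB.instance Definition _ := Lmodule_isPzAlgebra.Build R quotient
  quot_mulA quot_mul1 quot_mulr1 quot_mulDl quot_mulDr quot_scaleAl quot_scaleAr.

Fact proj_monoid : monoid_morphism proj.
Proof. by split=> // x y; rewrite -quot_mulE. Qed.
Fact proj_scalable : scalable proj.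
Proof. by move=> a x; rewrite -quot_scaleE. Qed.

HB.instance Definition _ := GRing.isMonoidMorphism.Build B quotient proj proj_monoid.
HB.instance Definition _ :=
  GRing.isScalable.Build R B quotient *:%R proj proj_scalable.

End Quotient.

Arguments quotient {R B} J.
Arguments proj {R B} J b.

Section QuotientMap.
Variables (R : pzRingType) (B : pzAlgType R) (J1 J2 : ideal B).

(* The choice of representative is immaterial when J1 is included in J2,
   see quot_mapE. *)
Definition quot_map (sJ : J1 `<=` J2) (x : quotient J1) : quotient J2 :=
  proj J2 (repr x).

Lemma quot_mapE (sJ : J1 `<=` J2) b : quot_map sJ (proj J1 b) = proj J2 b.
Proof. by apply/projP/sJ/quot_reprP. Qed.

End QuotientMap.

Section Covering.
Variables (R : pzRingType) (B : pzAlgType R) (I : finType) (J : I -> ideal B).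

Definition covering : Prop := \bigcap_(i in [set: I]) J i = [set 0].

(* Both maps have codomain B_ij = B / (J i + J j), so that no identification
   of B_ij with B_ji is needed: quot_proj_l i j is pi^i_j on B_i, and
   quot_proj_r i j is pi^j_i on B_j. *)
Definition quot_proj_l (i j : I) :
    quotient (J i) -> quotient (ideal_add (J i) (J j)) :=
  quot_map (@ideal_addl _ _ (J i) (J j)).

Definition quot_proj_r (i j : I) :
    quotient (J j) -> quotient (ideal_add (J i) (J j)) :=
  quot_map (@ideal_addr _ _ (J i) (J j)).

Definition covering_completion : set (forall i, quotient (J i)) :=
  [set a | forall i j, quot_proj_l j (a i) = quot_proj_r i (a j)].

Definition covering_map (b : B) : forall i, quotient (J i) :=
  fun i => proj (J i) b.

Lemma covering_map_fun : set_fun [set: B] covering_completion covering_map.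
Proof. by move=> b _ i j; rewrite /quot_proj_l /quot_proj_r !quot_mapE. Qed.

Lemma covering_map_inj : covering -> injective covering_map.
Proof.
move=> cJ x y eK; apply/subr0_eq.
suff : (\bigcap_(i in [set: I]) J i) (x - y) by rewrite cJ.
by move=> i _; apply/projP; exact: (congr1 (fun f => f i) eK).
Qed.

Definition covering_complete : Prop :=
  set_surj [set: B] covering_completion covering_map.

End Covering.

(* Main.v *)
(** Completeness is a Chinese remainder property: pairwise congruences
    [b_i = b_j] modulo [J_i + J_j] must have a common solution. If [b] solves
    the first [k] congruences, then [b - b_k] lies in every [J_i + J_k], [i < k];
    the distributivity hypothesis splits it as [x + y] with [x] in every earlier
    [J_i] and [y] in [J_k], and [b - x] solves one congruence more. *)
Require Import Defs.
From mathcomp Require Import all_boot all_order all_algebra.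
From mathcomp Require Import boolp classical_sets functions reals.
From mathcomp Require Import complex.
Import GRing.Theory.
Local Open Scope ring_scope.
Local Open Scope classical_set_scope.

Lemma idealD (R : pzRingType) (B : pzAlgType R) (J : ideal B) x y :
  ideal_set J x -> ideal_set J y -> ideal_set J (x + y).
Proof.
move=> Jx Jy; rewrite -[y]opprK -[- y]sub0r.
by apply: idealB => //; apply: idealB => //; exact: ideal0.
Qed.

(** [quot_map] projects the chosen representative, so compatibility in [B_ij] is already a
    congruence between representatives. *)
Lemma completion_repr_congr (R : pzRingType) (B : pzAlgType R) (I : finType)
    (J : I -> ideal B) (a : forall i, quotient (J i)) (i j : I) :
  covering_completion a ->
  ideal_set (ideal_add (J i) (J j)) (repr (a i) - repr (a j)).
Proof. by move=> /(_ i j) aij; apply/projP. Qed.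

Lemma chinese_remainder_lt (R : pzRingType) (B : pzAlgType R) (n : nat)
    (J : 'I_n -> ideal B) (b : 'I_n -> B) :
  (forall k : 'I_n,
     \bigcap_(i in [set i : 'I_n | (i < k)%N]) sumset (J i) (J k) `<=`
     sumset (\bigcap_(i in [set i : 'I_n | (i < k)%N]) J i) (J k)) ->
  (forall i j, ideal_set (ideal_add (J i) (J j)) (b i - b j)) ->
  forall m, (m <= n)%N ->
  exists c, forall i : 'I_n, (i < m)%N -> ideal_set (J i) (c - b i).
Proof.
move=> distrJ bJ; elim=> [|m IHm] lt_mn; first by exists 0.
have [c cJ] := IHm (ltnW lt_mn).
pose k := Ordinal lt_mn.
have : (\bigcap_(i in [set i : 'I_n | (i < k)%N]) sumset (J i) (J k)) (c - b k).
  (* Split [c - b k] as [(c - b i) + (b i - b k)]: the first term lies in [J i], the second in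
     [J i + J k]. *)
  move=> i /= lt_ik; rewrite -(subrK (b i) c) -addrA.
  by apply: (@idealD _ _ (ideal_add (J i) (J k))) => //; apply/ideal_addl/cJ.
move=> /distrJ[x Jx [y Jy xy]]; exists (c - x) => i.
rewrite ltnS leq_eqVlt => /orP[/eqP im|lt_im].
  have -> : i = k by exact: val_inj.
  (* Here [c - x - b k] is exactly [y]. *)
  by rewrite addrAC -xy addrC addKr.
by rewrite addrAC; apply: idealB; [exact: cJ | exact: Jx].
Qed.

Theorem proposition3 (R : realType) (B : pzAlgType R[i]) (n : nat)
    (J : 'I_n -> ideal B) (cJ : covering J)
    (distrJ : forall k : 'I_n,
       \bigcap_(i in [set i : 'I_n | (i < k)%N]) sumset (J i) (J k) =
       sumset (\bigcap_(i in [set i : 'I_n | (i < k)%N]) J i) (J k)) :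
  covering_complete J.
Proof.
move=> a acompl.
have bJ i j := completion_repr_congr _ _ _ _ _ i j acompl.
(* At [m = n] the solution covers every index. *)
have [||c cb] := chinese_remainder_lt _ _ _ J (fun i => repr (a i)) _ _ n (leqnn n).
- by move=> k; rewrite distrJ.
- exact: bJ.
exists c => //; apply: functional_extensionality_dep => i.
by rewrite /covering_map -[RHS]projK; apply/projP/cb.
Qed.
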